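(* Let $\prec$ be a compatible weak preference on a real vector space $Y$ with positive cone $P_\prec$. For each open component $E\in\mathcal{O}(P_\prec)$ there is a nonzero linear function $\phi_E:Y\to\mathbb{R}$ such that $$E=\{y\in\mathrm{Lin}(E)\mid\phi_E(y)>0\}\quad\text{and}\quad L_E=\{y\in\mathrm{Lin}(E)\mid\phi_E(y)=0\}.$$ Furthermore, $\phi_E(y)=0$ for all $y\in\mathrm{Lin}(\tilde E)$ whenever $\tilde E\in\mathcal{O}(P_\prec)$ and $\tilde E\lhd^*E$.
   Context: A partial preference on $Y$ is an asymmetric and transitive binary relation $\prec$. It is a weak preference if its indifference relation ($y\asymp z$ iff neither $y\prec z$ nor $z\prec y$) is transitive. It is compatible if $y_1\prec y_2$ implies $\lambda y_1\prec\lambda y_2$ and $y_1+y\prec y_2+y$ for all $y\in Y$ and all real $\lambda>0$. Its positive cone is $P_\prec=\{y\in Y\mid 0\prec y\}$; then $y_1\prec y_2\iff y_2-y_1\in P_\prec$. Majorization: for $y,z\in P_\prec$ write $y\unlhd z$ if there is a real $\mu>0$ with $\mu y\prec z$. This is a preorder; write $y\approx z$ if $y\unlhd z$ and $z\unlhd y$. The equivalence classes $\mathcal{O}(P_\prec)=P_\prec/\!\approx$ are called the open components of $P_\prec$ (each is a convex cone). They are partially ordered by $\unlhd^*$: $E_1\unlhd^*E_2$ iff $y_1\unlhd y_2$ for all (equivalently, some) $y_1\in E_1$, $y_2\in E_2$; and $E_1\lhd^*E_2$ means $E_1\unlhd^*E_2$ and $E_1\ne E_2$. For a convex cone $K\subset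 Y$: $\mathrm{Lin}(K)=K-K$ is its linear hull, and $L_K=\{h\in Y\mid y+th\in K\text{ for all }y\in K\text{ and all }t\in\mathbb{R}\}$ is the vector space associated with $K$. *)

(* Defs.v *)
From Corelib Require Export RelationClasses.
From mathcomp Require Export all_boot all_order all_algebra.
From mathcomp Require Export boolp classical_sets reals.

Set Implicit Arguments.
Unset Strict Implicit.
Unset Printing Implicit Defensive.

Import Order.TTheory GRing.Theory Num.Theory.
Local Open Scope classical_set_scope.
Local Open Scope ring_scope.

Definition partial_preference (Y : Type) (prec : Y -> Y -> Prop) : Prop :=
  Asymmetric prec /\ Transitive prec.

Definition indifferent (Y : Type) (prec : Y -> Y -> Prop) (y z : Y) : Prop :=
  ~ prec y z /\ ~ prec z y.

Definition weak_preference (Y : Type) (prec : Y -> Y -> Prop) : Prop :=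
  partial_preference prec /\ Transitive (indifferent prec).

Definition compatible (R : realType) (Y : lmodType R)
    (prec : Y -> Y -> Prop) : Prop :=
  forall y1 y2 : Y, prec y1 y2 ->
    (forall lambda : R, 0 < lambda -> prec (lambda *: y1) (lambda *: y2)) /\
    (forall y : Y, prec (y1 + y) (y2 + y)).

Definition positive_cone (R : realType) (Y : lmodType R)
    (prec : Y -> Y -> Prop) : set Y :=
  [set y | prec 0 y].

(* Only used for y and z in the positive cone. *)
Definition majorized (R : realType) (Y : lmodType R)
    (prec : Y -> Y -> Prop) (y z : Y) : Prop :=
  exists mu : R, 0 < mu /\ prec (mu *: y) z.

Definition major_equiv (R : realType) (Y : lmodType R)
    (prec : Y -> Y -> Prop) (y z : Y) : Prop :=
  majorized prec y z /\ majorized prec z y.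

(* The quotient of the positive cone by [major_equiv], as a set of subsets
   of Y. *)
Definition open_components (R : realType) (Y : lmodType R)
    (prec : Y -> Y -> Prop) : set (set Y) :=
  [set E | exists2 z : Y, positive_cone prec z &
     E = [set y | positive_cone prec y /\ major_equiv prec y z]].

Definition component_le (R : realType) (Y : lmodType R)
    (prec : Y -> Y -> Prop) (E1 E2 : set Y) : Prop :=
  forall y1 y2 : Y, E1 y1 -> E2 y2 -> majorized prec y1 y2.

Definition component_lt (R : realType) (Y : lmodType R)
    (prec : Y -> Y -> Prop) (E1 E2 : set Y) : Prop :=
  component_le prec E1 E2 /\ E1 <> E2.

(* Lin(K) = K - K; this is the linear hull when K is a nonempty convex cone. *)
Definition Lin (R : realType) (Y : lmodType R) (K : set Y) : set Y :=
  [set u - v | u in K & v in K].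

Definition assoc_space (R : realType) (Y : lmodType R) (K : set Y) : set Y :=
  [set h | forall y : Y, K y -> forall t : R, K (y + t *: h)].

(* Main.v *)
(** Fix [z] in [E]. Completeness of the weak preference makes every [y] with
    [- m z < y < m z] comparable with all but at most one multiple of [z], so
    the cut [sup {t | t z < y}] is a linear function of such [y], and these [y]
    make up [Lin E]. It is positive exactly on [E], and vanishes on the smaller
    components, whose elements lie below every positive multiple of [z].
    Zorn's lemma extends it to all of [Y]. *)
From HB Require Import structures.
Require Import Defs.
From mathcomp Require Import ring lra.

Set Implicit Arguments.
Unset Strict Implicit.
Unset Printing Implicit Defensive.

Import Order.TTheory GRing.Theory Num.Theory.
Local Open Scope classical_set_scope.
Local Open Scope ring_scope.

(** * Extending partial linear maps, viewed as graphs *)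

Section LinearGraphExtension.
Variables (K : fieldType) (V W : lmodType K).
Implicit Types (G H : set (V * W)).

(** A partial linear map given by its graph: for a subspace, being single-valued over 0 is the same
    as being single-valued everywhere. *)
Definition linear_graph G :=
  (forall a p q, G p -> G q -> G (a *: p + q)) /\
  (forall w, G (0, w) -> w = 0).

Lemma linear_graph0 G p : linear_graph G -> G p -> G 0.
Proof.
by move=> [lG _] Gp; have := lG (-1) _ _ Gp Gp; rewrite scaleN1r addNr.
Qed.

Lemma linear_graphZ G a p : linear_graph G -> G p -> G (a *: p).
Proof.
move=> lG Gp; rewrite -[_ *: _]addr0; apply: lG.1 => //.
exact: linear_graph0 lG Gp.
Qed.

Lemma linear_graph_inj G x w w' :
  linear_graph G -> G (x, w) -> G (x, w') -> w = w'.
Proof.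
move=> [lG fG] Gw Gw'; apply/esym/eqP.
rewrite -subr_eq0 addrC -scaleN1r; apply/eqP/fG.
have -> : (0, -1 *: w + w') = -1 *: (x, w) + (x, w') :> V * W.
  by congr (_, _); rewrite /= scaleN1r addNr.
exact: lG.
Qed.

(** The partial map is extended by the value 0 at [x]. It stays single-valued: a vector over 0 with
    coefficient [c] nonzero would make [x] a multiple of some [y] in the domain of [H]. *)
Lemma linear_graph_adjoin H x :
  linear_graph H -> H 0 -> (forall w, ~ H (x, w)) ->
  linear_graph [set p | exists2 h, H h & exists c, p = c *: (x, 0) + h].
Proof.
move=> lH H0 Hx; split=> [a _ _ [p Hp [c ->]] [q Hq [d ->]]|w [[y v] Hyv [c]]].
  exists (a *: p + q); first exact: lH.1.
  exists (a * c + d).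
  by rewrite scalerDr scalerA [in RHS]scalerDl addrACA.
case=> e ->; rewrite scaler0 add0r.
have [c0|c0] := eqVneq c 0.
  by move: e; rewrite c0 scale0r add0r => /esym y0; apply: lH.2; rewrite -y0.
exfalso; apply: (Hx (- c^-1 *: v)).
suff -> : (x, - c^-1 *: v) = - c^-1 *: (y, v) by exact: linear_graphZ.
congr (_, _) => /=.
have -> : y = - (c *: x) by apply/eqP; rewrite -addr_eq0 addrC -e.
by rewrite scalerN scaleNr opprK scalerA mulVf // scale1r.
Qed.

Lemma linear_graph_extension G : linear_graph G -> G 0 ->
  exists f : V -> W, linear f /\ forall p, G p -> f p.1 = p.2.
Proof.
move=> lG G0.
(* The empty set is admitted because [Zorn_bigcup] also asks for the union of
   the empty chain. *)
pose ext H := linear_graph H /\ (H !=set0 -> G `<=` H).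
have [F FP Ftot|H [[lH GH] Hmax]] := @Zorn_bigcup _ ext.
  split; last first.
    move=> [p [X FX Xp]] q Gq; exists X => //.
    by apply: (FP _ FX).2 => //; exists p.
  split=> [a p q [X FX Xp] [Z FZ Zq]|w [X FX]]; last exact: (FP _ FX).1.2.
  have [XZ|ZX] := Ftot _ _ FX FZ.
    by exists Z => //; apply: (FP _ FZ).1.1 => //; exact: XZ.
  by exists X => //; apply: (FP _ FX).1.1 => //; exact: ZX.
have {}GH : G `<=` H.
  apply: GH; apply: contrapT => /nonemptyPn H0.
  (* A maximal element cannot be empty, since [G] contains 0 and would be strictly larger. *)
  apply: (Hmax G); last by split=> // _ p.
  by rewrite H0; split=> // /(_ _ G0).
have H0 : H 0 by exact: GH.
have /choice[f Hf] : forall x, exists w, H (x, w).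
  move=> x; apply: contrapT => /forallNP Hx.
  apply: (Hmax [set p | exists2 h, H h & exists c, p = c *: (x, 0) + h]).
    split=> [h Hh|]; first by exists h => //; exists 0; rewrite scale0r add0r.
    by move=> /(_ (x, 0)) Hx0; apply/(Hx 0)/Hx0; exists 0 => //; exists 1;
       rewrite scale1r addr0.
  split; first exact: linear_graph_adjoin.
  by move=> _ h /GH Hh; exists h => //; exists 0; rewrite scale0r add0r.
exists f; split=> [a x y|[x w] /GH Gxw].
  apply: (linear_graph_inj lH (Hf _)).
  exact: (lH.1 a (x, f x) (y, f y)).
exact: (linear_graph_inj lH (Hf _)).
Qed.

End LinearGraphExtension.

(** * Order rules for a compatible weak preference *)

Section Preference.
Variables (R : realType) (Y : lmodType R) (prec : Y -> Y -> Prop).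
Hypothesis prec_weak : weak_preference prec.
Hypothesis prec_compat : compatible prec.
Local Infix "≺" := prec (at level 70).

Let prec_trans y x z : x ≺ y -> y ≺ z -> x ≺ z.
Proof. exact: prec_weak.1.2. Qed.

Let prec_irr x : ~ x ≺ x.
Proof. by move=> xx; exact: (prec_weak.1.1 _ _ xx xx). Qed.

(** If both alternatives fail, [y] is indifferent to [x] and to [z], so transitivity of indifference
    contradicts [x ≺ z]. *)
Lemma prec_cotrans y x z : x ≺ z -> x ≺ y \/ y ≺ z.
Proof.
move=> xz; apply: contrapT => /not_orP[xy yz].
have yx : ~ y ≺ x by move=> yx; apply: yz; exact: prec_trans xz.
have zy : ~ z ≺ y by move=> zy; apply: xy; exact: prec_trans zy.
by have [] := prec_weak.2 _ _ _ (conj xy yx) (conj yz zy).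
Qed.

Lemma precD x y x' y' : x ≺ y -> x' ≺ y' -> x + x' ≺ y + y'.
Proof.
move=> xy xy'; apply: (@prec_trans (y + x')); first exact: (prec_compat xy).2.
by rewrite ![y + _]addrC; exact: (prec_compat xy').2.
Qed.

Lemma precD2r y x x' : (x + y ≺ x' + y) <-> x ≺ x'.
Proof.
split=> [xx'|xx']; last exact: (prec_compat xx').2.
by have := (prec_compat xx').2 (- y); rewrite !addrK.
Qed.

Lemma precZ a x y : 0 < a -> x ≺ y -> a *: x ≺ a *: y.
Proof. by move=> a0 xy; exact: (prec_compat xy).1. Qed.

Lemma precN x y : x ≺ y -> - y ≺ - x.
Proof.
move=> xy.
by rewrite -(precD2r (x + y)) [x + y]addrC addKr addrCA addNr addr0. Qed.

Lemma precZV a x y : 0 < a -> (a *: x ≺ y) <-> (x ≺ a^-1 *: y).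
Proof.
move=> a0; split=> xy.
  have := precZ (a := a^-1) _ xy; rewrite invr_gt0 scalerA mulVf ?gt_eqF //.
  by rewrite scale1r; apply.
by have := precZ a0 xy; rewrite scalerA divff ?gt_eqF // scale1r.
Qed.

Lemma majorized_trans y x w :
  majorized prec x y -> majorized prec y w -> majorized prec x w.
Proof.
move=> [m [m0 mxy]] [n [n0 nyw]]; exists (n * m); split; first exact: mulr_gt0.
by rewrite -scalerA; exact: prec_trans (precZ n0 mxy) nyw.
Qed.

Lemma major_equiv_trans y x w :
  major_equiv prec x y -> major_equiv prec y w -> major_equiv prec x w.
Proof.
by move=> [xy yx] [yw wy]; split;
   [exact: majorized_trans yw|exact: majorized_trans yx].
Qed.

Lemma open_components_disjoint E1 E2 y :
  open_components prec E1 -> open_components prec E2 -> E1 y -> E2 y -> E1 = E2.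
Proof.
move=> [z1 _ ->] [z2 _ ->] [_ yz1] [_ yz2].
have sym a b : major_equiv prec a b -> major_equiv prec b a by case; split.
have zz := major_equiv_trans (sym _ _ yz1) yz2.
apply/seteqP; split=> x [x0 xz]; split=> //; first exact: major_equiv_trans zz.
exact: major_equiv_trans (sym _ _ zz).
Qed.

Variable z : Y.
Hypothesis z_gt0 : 0 ≺ z.

Lemma prec_scale s t : s < t -> s *: z ≺ t *: z.
Proof.
move=> st; rewrite -(precD2r (- (s *: z))) subrr -scalerBl.
by rewrite -(scaler0 _ (t - s)); apply: precZ => //; rewrite subr_gt0.
Qed.

(** * The cut along multiples of [z] *)

(** The cut is kept as a relation, so that its linearity is checked without suprema. Both
    inequalities are strict: nothing is said about [t] equal to the cut. *)
Definition cut_graph : set (Y * R^o) :=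
  [set p | (forall t, t < p.2 -> t *: z ≺ p.1) /\
           (forall t, p.2 < t -> p.1 ≺ t *: z)].

Lemma cut_graph_gen : cut_graph (z, 1).
Proof.
split=> t /= t1; first by rewrite -[X in _ ≺ X](scale1r z); exact: prec_scale.
by rewrite -[X in X ≺ _](scale1r z); exact: prec_scale.
Qed.

Lemma cut_graphD p q : cut_graph p -> cut_graph q -> cut_graph (p + q).
Proof.
move: p q => [x s] [y s'] [/= sx xs] [/= sy ys].
(* The gap between [t] and [s + s'] is shared equally, so each summand stays strictly on the correct
   side of its own cut. *)
have half t : t = (s - (s + s' - t) / 2) + (s' - (s + s' - t) / 2) by field.
have -> : (x, s) + (y, s') = (x + y, s + s') :> Y * R^o by [].
split=> t /= tss; rewrite [t in t *: _]half scalerDl; apply: precD.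
- by apply: sx; lra.
- by apply: sy; lra.
- by apply: xs; lra.
- by apply: ys; lra.
Qed.

Lemma cut_graphZ a p : cut_graph p -> cut_graph (a *: p).
Proof.
move: p => [x s] [/= sx xs].
have -> : a *: (x, s) = (a *: x, a * s) :> Y * R^o by [].
have [a0|a0|->] := ltgtP a 0.
(* Compatibility covers positive scalars only; the remaining negation exchanges the lower and upper
   bounds. *)
- have split t : t *: z = - ((- a) *: ((t / a) *: z)).
    by rewrite scalerA -scaleNr; congr (_ *: _); field; rewrite lt_eqF.
  have Na0 : 0 < - a by rewrite oppr_gt0.
  have xE : a *: x = - ((- a) *: x) by rewrite scaleNr opprK.
  split=> t /= tas; rewrite split xE; apply/precN/precZ => //.
    by apply: xs; rewrite ltr_ndivlMr // mulrC.
  by apply: sx; rewrite ltr_ndivrMr // mulrC.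
- have split t : t *: z = a *: ((t / a) *: z).
    by rewrite scalerA; congr (_ *: _); field; rewrite gt_eqF.
  split=> t /= tas; rewrite split; apply: precZ => //.
    by apply: sx; rewrite ltr_pdivrMr // mulrC.
  by apply: xs; rewrite ltr_pdivlMr // mulrC.
- split=> t /=; rewrite mul0r scale0r => t0.
    by rewrite -[X in _ ≺ X](scale0r z); exact: prec_scale.
  by rewrite -[X in X ≺ _](scale0r z); exact: prec_scale.
Qed.

Lemma cut_graph_linear : linear_graph cut_graph.
Proof.
split=> [a p q Gp Gq|w [/= w0 w1]]; first exact/cut_graphD/Gq/cut_graphZ.
(* As [w / 2] lies strictly between 0 and [w], its multiple of [z] would be both above and below
   0. *)
have [w_lt0|w_gt0|//] := ltgtP w 0; exfalso.
  apply: (@prec_irr 0); apply: (@prec_trans ((w / 2) *: z)); first by apply: w1; lra.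
  by rewrite -[X in _ ≺ X](scale0r z); apply: prec_scale; lra.
apply: (@prec_irr 0); apply: (@prec_trans ((w / 2) *: z)); last by apply: w0; lra.
by rewrite -[X in X ≺ _](scale0r z); apply: prec_scale; lra.
Qed.

Lemma cut_graph00 : cut_graph 0.
Proof. by have := cut_graphZ 0 cut_graph_gen; rewrite scale0r. Qed.

Definition squeezed y := exists2 m, - m *: z ≺ y & y ≺ m *: z.

Lemma squeezed_cut y : squeezed y -> exists c, cut_graph (y, c).
Proof.
move=> [m my ym]; pose A := [set t : R | t *: z ≺ y].
have Aub t : A t -> t <= m.
  move=> At; rewrite leNgt; apply/negP => mt.
  exact: prec_irr (prec_trans At (prec_trans ym (prec_scale mt))).
have supA : has_sup A by split; [exists (- m)|exists m].
exists (sup A); split=> t /= tA.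
  have [s As] := sup_adherent (eps := sup A - t) (ltac:(by rewrite subr_gt0)) supA.
  rewrite opprB addrC subrK => ts.
  exact: prec_trans (prec_scale ts) As.
(* A vector may be incomparable with one multiple of [z], so cotransitivity is applied to two of
   them, at the midpoint and at [t]. The midpoint exceeds the supremum, which leaves only
   [y ≺ t *: z]. *)
have sAt : sup A < (sup A + t) / 2 by lra.
have [As|//] := prec_cotrans y (@prec_scale ((sup A + t) / 2) t ltac:(lra)).
by move: sAt; rewrite ltNge (ub_le_sup supA.2).
Qed.

(** * The open component of [z] and its linear hull *)

Let E := [set y | positive_cone prec y /\ major_equiv prec y z].

(** Inverting the factors of majorization turns equivalence with [z] into bounds by multiples of
    [z]; positivity of [m] follows from [0 ≺ y ≺ m *: z]. *)
Lemma componentP y :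
  E y <-> (exists2 k, 0 < k & k *: z ≺ y) /\ (exists m, y ≺ m *: z).
Proof.
split=> [[y0 [[k [k0 kyz]] [m [m0 mzy]]]]|[[k k0 kzy] [m ym]]].
  by split; [exists m|exists k^-1; rewrite -precZV].
have y0 : 0 ≺ y by rewrite -(scale0r z); exact: prec_trans (prec_scale k0) kzy.
split=> //; split; last by exists k.
have m0 : 0 < m.
  rewrite ltNge; apply/negP; rewrite le_eqVlt => /predU1P[m0|m0].
    by move: ym; rewrite m0 scale0r => y0'; exact: prec_irr (prec_trans y0 y0').
  apply: prec_irr (prec_trans y0 (prec_trans ym _)).
  by rewrite -[X in _ ≺ X](scale0r z); exact: prec_scale.
by exists m^-1; split; rewrite ?invr_gt0// precZV ?invr_gt0// invrK.
Qed.

Lemma Lin_componentP y : Lin E y <-> squeezed y.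
Proof.
split=> [[u /componentP[[k k0 ku] [m um]]
        [v /componentP[[l l0 lv] [n vn]] <-]]|[m my ym]].
  have bound a b x : 0 < a -> a *: z ≺ x -> x ≺ b *: z -> 0 < b.
    move=> a0 ax xb; rewrite ltNge; apply/negP => b0.
    have ba := prec_scale (le_lt_trans b0 a0).
    exact: prec_irr (prec_trans (prec_trans ax xb) ba).
  have m0 := bound _ _ _ k0 ku um; have n0 := bound _ _ _ l0 lv vn.
  exists (m + n).
    apply: (@prec_trans ((k - n) *: z)); first by apply: prec_scale; lra.
    by rewrite scalerBl; exact: precD ku (precN vn).
  apply: (@prec_trans ((m - l) *: z)); last by apply: prec_scale; lra.
  by rewrite scalerBl; exact: precD um (precN lv).
have m0 : 0 < m.
  rewrite ltNge; apply/negP; rewrite le_eqVlt => /predU1P[m0|m0].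
    by apply: prec_irr (prec_trans my _); rewrite m0 oppr0 -{1}m0.
  apply: prec_irr (prec_trans my (prec_trans ym (prec_scale _))); lra.
(* Shifting by [m + 1] raises the lower bound [- m *: z] of [y] to [z] itself, so both terms of the
   difference lie in [E]. *)
exists (y + (m + 1) *: z); last exists ((m + 1) *: z); last by rewrite addrK.
  apply/componentP; split; last first.
    by exists (m + (m + 1)); rewrite (scalerDl z m (m + 1)) precD2r.
  exists 1; rewrite ?ltr01//.
  by rewrite -[X in X *: z](addKr m) (scalerDl z (- m) (m + 1)) precD2r.
apply/componentP; split; last by exists (m + 2); apply: prec_scale; lra.
by exists 1; rewrite ?ltr01//; apply: prec_scale; lra.
Qed.

(** The normalization at [z] makes [phi] nonzero; on [Lin E] its values are the cuts. *)
Lemma cut_functional_exists : exists phi : {scalar Y},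
  phi z = 1 /\ forall y, Lin E y -> cut_graph (y, phi y).
Proof.
have [f [lf Gf]] := linear_graph_extension cut_graph_linear cut_graph00.
pose phi : {scalar Y} := HB.pack f (GRing.isLinear.Build _ _ _ _ f lf).
exists phi; split; first exact: (Gf _ cut_graph_gen).
move=> y /Lin_componentP/squeezed_cut[c Gyc].
by rewrite /phi/= (Gf _ Gyc).
Qed.

Lemma component_sub_Lin : E `<=` Lin E.
Proof.
move=> y /componentP[[k k0 kzy] [m ym]]; apply/Lin_componentP.
have km : k < m.
  rewrite ltNge; apply/negP; rewrite le_eqVlt => /predU1P[km|mk].
    by move: ym; rewrite km => yk; exact: prec_irr (prec_trans kzy yk).
  exact: prec_irr (prec_trans kzy (prec_trans ym (prec_scale mk))).
exists m => //; apply: prec_trans kzy; apply: prec_scale; lra.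
Qed.

Lemma component_cut_gt0 y c : cut_graph (y, c) -> (E y <-> 0 < c).
Proof.
move=> [/= cy yc]; split=> [/componentP[[k k0 kzy] _]|c0].
  rewrite ltNge; apply/negP => c0.
  apply: prec_irr (prec_trans kzy _); apply: yc; exact: le_lt_trans k0.
apply/componentP; split; last by exists (c + 1); apply: yc; lra.
(* Half of [c] is taken because [c *: z] need not be below [y]. *)
by exists (c / 2); [lra|apply: cy; lra].
Qed.

End Preference.

Theorem proposition4p13 (R : realType) (Y : lmodType R)
    (prec : Y -> Y -> Prop)
    (prec_weak : weak_preference prec) (prec_compat : compatible prec)
    (E : set Y) (E_comp : open_components prec E) :
  exists phi : {scalar Y},
    [/\ exists y : Y, phi y != 0,
        E = [set y | Lin E y /\ 0 < phi y],
        assoc_space E = [set y | Lin E y /\ phi y = 0]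
      & forall E' : set Y, open_components prec E' -> component_lt prec E' E ->
          forall y : Y, Lin E' y -> phi y = 0].
Proof.
have [z z0 EE] := E_comp.
have [phi [phi_z phi_cut]] := cut_functional_exists prec_weak prec_compat z0.
rewrite -EE in phi_cut.
have E_phi y : Lin E y -> (E y <-> 0 < phi y).
  by move=> /phi_cut/(component_cut_gt0 prec_weak prec_compat z0); rewrite -EE.
have E_sub : E `<=` Lin E.
  by rewrite EE; exact: component_sub_Lin.
have LinE y : Lin E y <-> squeezed prec z y.
  by rewrite EE; exact: Lin_componentP.
have Ez : E z.
  have /(component_cut_gt0 prec_weak prec_compat z0) := cut_graph_gen prec_compat z0.
  by rewrite EE => ->.
exists phi; split.
- by exists z; rewrite phi_z oner_neq0.
- apply/seteqP; split=> y => [Ey|[Ly]]; last by move/(E_phi _ Ly).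
  by split; [exact: E_sub|apply/E_phi => //; exact: E_sub].
- apply/seteqP; split=> h => [Eh|[Lh h0] y Ey t].
    (* Here [h] is the difference of [z + h] and [z], both in [E]. *)
    have Lh : Lin E h.
      exists (z + 1 *: h); first exact: Eh.
      by exists z; rewrite // scale1r addrC addKr.
    split=> //; apply/eqP; apply: contrapT => /negP h0.
    (* This multiple of [h] carries [z] to a point where [phi] is 0, yet the point must still lie in
       [E], where [phi] is positive. *)
    have Et := Eh _ Ez (- (phi h)^-1).
    move/(E_phi _ (E_sub _ Et)): Et.
    by rewrite linearD linearZ /= phi_z mulNr mulVf // subrr ltxx.
  (* Adding cuts gives membership in [E] directly, without first placing [y + t *: h] in [Lin E]. *)
  have : cut_graph prec z (y + t *: h, phi y + t * phi h).
    have -> : (y + t *: h, phi y + t * phi h)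
        = (y, phi y) + t *: ((h, phi h) : Y * R^o) :> Y * R^o by [].
    apply: cut_graphD => //; first by apply: phi_cut; exact: E_sub.
    by apply: cut_graphZ => //; exact: phi_cut.
  move=> /(component_cut_gt0 prec_weak prec_compat z0); rewrite -EE => ->.
  by rewrite h0 mulr0 addr0; apply/E_phi => //; exact: E_sub.
- move=> E' E'_comp [E'_le E'_neq].
  have phi0 y : E' y -> phi y = 0.
    move=> E'y; have y0 : prec 0 y by case: E'_comp E'y => z' _ -> [].
    have [m [m0 myz]] := E'_le _ _ E'y Ez.
    have Ly : Lin E y.
      apply/LinE; exists m^-1; last by rewrite -precZV.
      apply: prec_weak.1.2 y0; rewrite -(scale0r z); apply: prec_scale => //.
      by rewrite oppr_lt0 invr_gt0.
    (* A positive value would put [y] in [E] and so force [E' = E]; a negative one would put [y]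
       below 0. *)
    apply/eqP; rewrite eq_le; apply/andP; split; rewrite leNgt; apply/negP.
      move=> /(E_phi _ Ly) Ey; apply: E'_neq.
      exact: (open_components_disjoint prec_weak prec_compat E'_comp E_comp E'y Ey).
    move=> /(phi_cut _ Ly).2; rewrite scale0r => y_lt0.
    exact: prec_weak.1.1 y0 y_lt0.
  by move=> _ [u E'u [v E'v <-]]; rewrite linearB /= !phi0 // subr0.
Qed.
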